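(* Let $\alpha$ be a countable ordinal, let $\psi_\alpha$ be the $\mathcal{L}_{\omega_1,\omega}$-sentence defined in the context, and let $(\mathbf{K}_\alpha,\prec_{\mathbf{K}_\alpha})$ be the class of models of $\psi_\alpha$ with the substructure relation. Then $(\mathbf{K}_\alpha,\prec_{\mathbf{K}_\alpha})$ is an Abstract Elementary Class with countable L\''owenheim-Skolem number.
   Context: The sentence $\psi_\alpha$. Fix a countable ordinal $\alpha$. The vocabulary $\tau$ has constants $0$ and $c_n$ ($n\in\omega$), unary predicates $L_\beta$ ($0\le\beta\le\alpha+1$), binary relation symbols $S,V,T$ and $<_\beta$ ($1\le\beta\le\alpha+1$), and ternary relation symbols $F_\beta$ ($0\le\beta\le\alpha$) and $G$. Write $V(a)=\{x: V(a,x)\}$. Saying that $F(x,\cdot,\cdot)$ is a surjection from $A$ to $B$ means that $\{(y,z):F(x,y,z)\}$ is the graph of a surjection $A\to B$. $\psi_\alpha$ is the $\mathcal{L}_{\omega_1,\omega}(\tau)$-sentence that is the conjunction of the following requirements. (a) $L_{\alpha+1}$ is linearly ordered by $<_{\alpha+1}$ with minimum $0$; it may or may not have a maximum element. Every non-maximum $a\in L_{\alpha+1}$ has an immediate successor $b$, and $S(a,b)$ expresses that $b$ is the successor of $a$. The maximum, if it exists, is called $m$ and is not a successor. (b) For $a\in L_{\alpha+1}$, $V(a)$ is the set of nodes at level $a$; it is disjoint from every $L_\beta$, and $V(a)\cap V(b)=\emptyset$ for $a\ne b$. The universe is the union of all the $L_\beta$ and all the $V(a)$. (c) $T$ is a tree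 ordering on $V=\bigcup_{a\in L_{\alpha+1}}V(a)$. If $T(x,y)$, then the level of $x$ is strictly below the level of $y$. If $y\in V(a)$ and $b<_{\alpha+1}a$, there is $x\in V(b)$ with $T(x,y)$. If $a$ is a limit (neither a successor nor $0$), two distinct elements of $V(a)$ do not have the same $T$-predecessors. The tree is pruned (every node is contained in a maximal branch). If $m$ exists, the elements of $V(m)$ play the role of maximal branches through the tree (a model need not contain all maximal branches). (d) $\forall x\,(L_0(x)\leftrightarrow\bigvee_n x=c_n)$, so $L_0$ has size $\aleph_0$. (e) Each $L_\beta$, $1\le\beta\le\alpha$, is linearly ordered by $<_\beta$ and may or may not have a maximum. For limit $\beta$, $L_\beta=\bigcup_{\gamma<\beta}L_\gamma$ (the order $<_\beta$ being unrelated to the previous orders). (f) For $\beta<\alpha$ and every $x\in L_{\beta+1}$, $F_\beta(x,\cdot,\cdot)$ is a surjection from $L_\beta$ to $\{b\in L_{\beta+1}: b\le_{\beta+1}x\}$. (g) For every $x\in L_{\alpha+1}$ that is not the maximum of $L_{\alpha+1}$, $F_\alpha(x,\cdot,\cdot)$ is a surjection from $L_\alpha$ to $\{b\in L_{\alpha+1}:b\le_{\alpha+1}x\}$ and $G(x,\cdot,\cdot)$ is a surjection from $L_\alpha$ to $V(x)$. $\mathbf{K}_\alpha$ is the class of all models of $\psi_\alpha$, and $M\prec_{\mathbf{K}_\alpha}N$ means that $M,N\in\mathbf{K}_\alpha$ and $M$ is a substructure of $N$. Countable L\''owenheim-Skolem number means $LS(\mathbf{K}_\alpha)=\aleph_0$: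 for every $N\in\mathbf{K}_\alpha$ and $X\subseteq N$ there is $M\prec_{\mathbf{K}_\alpha}N$ containing $X$ with $|M|\le|X|+\aleph_0$. *)

(* Defs.v *)
From HB Require Import structures.
From mathcomp Require Import all_boot all_classical.
From mathcomp Require Import wochoice.

Set Implicit Arguments.
Unset Strict Implicit.
Unset Printing Implicit Defensive.

Local Open Scope classical_set_scope.

(* An ordinal is represented by a well-ordered type of that order type: the
   elements of [alpha] stand for the ordinals below [alpha]. *)
Record countable_ordinal := CountableOrdinal {
  ordinal_sort :> countType;
  ole : rel ordinal_sort;
  ole_wo : well_order ole
}.

Definition olt (alpha : countable_ordinal) (b c : alpha) : bool :=
  ole b c && (b != c).

Definition ole_succ (alpha : countable_ordinal) : rel (option alpha) :=
  fun b c => match b, c with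
             | _, None => true
             | None, Some _ => false
             | Some b, Some c => ole b c
             end.

Lemma ole_succ_wo (alpha : countable_ordinal) : well_order (@ole_succ alpha).
Proof.
have wo := @ole_wo alpha.
have le_anti : antisymmetric (@ole alpha).
  have woT : wo_chain (@ole alpha) predT by move=> A _; apply: wo.
  by move=> b c; apply: (wo_chain_antisymmetric woT).
apply: antisymmetric_well_order.
  by case=> [b|] [c|] //= /le_anti ->.
move=> A [a Aa].
have [[b Ab]|noS] := pselect (exists b, Some b \in A).
  have ne : nonempty [pred c | Some c \in A] by exists b; rewrite inE.
  have [z [[zA zmin] _]] := wo _ ne.
  exists (Some z); split; first by rewrite inE in zA.
  by case=> [c|] //= cA; apply: zmin; rewrite inE.
case: a Aa => [b|] Aa; first by case: noS; exists b.
by exists None; split=> // -[c|] // cA; case: noS; exists c.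
Qed.

(* The ordinal [alpha + 1]: [Some b] is [b < alpha] and [None] is [alpha]. *)
Definition osucc (alpha : countable_ordinal) : countable_ordinal :=
  CountableOrdinal (@ole_succ_wo alpha).

Definition is_zero (alpha : countable_ordinal) (b : alpha) : bool :=
  `[< forall c, ole b c >].

Definition is_succ (alpha : countable_ordinal) (b c : alpha) : Prop :=
  olt b c /\ ~ exists d, olt b d /\ olt d c.

Definition is_limit (alpha : countable_ordinal) (c : alpha) : Prop :=
  ~~ is_zero c /\ ~ exists b, is_succ b c.

(* Vocabularies without function symbols of positive arity. *)
Record vocabulary := Vocabulary {
  rel_sym : Type;
  arity : rel_sym -> nat;
  const_sym : Type
}.

Inductive term (tau : vocabulary) :=
| Var of nat
| Const of const_sym tau.

Arguments Var {tau}.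
Arguments Const {tau}.

(* Since [I] is a [countType], [Conj D f] and [Disj D f] are the countable
   conjunction and disjunction of the [f i] for [i] in [D]. *)
Inductive formula (tau : vocabulary) : Type :=
| Eq (s t : term tau)
| Rel (r : rel_sym tau) (ts : (arity r).-tuple (term tau))
| Neg (f : formula tau)
| And (f g : formula tau)
| Or (f g : formula tau)
| Imp (f g : formula tau)
| Conj (I : countType) (D : set I) (f : I -> formula tau)
| Disj (I : countType) (D : set I) (f : I -> formula tau)
| All (x : nat) (f : formula tau)
| Ex (x : nat) (f : formula tau).

Definition term_fv (tau : vocabulary) (t : term tau) : set nat :=
  if t is Var x then [set x] else set0.

Fixpoint fv (tau : vocabulary) (f : formula tau) : set nat :=
  match f with
  | Eq s t => term_fv s `|` term_fv t
  | Rel r ts => [set x | exists i, term_fv (tnth ts i) x]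
  | Neg f => fv f
  | And f g | Or f g | Imp f g => fv f `|` fv g
  | Conj _ D f | Disj _ D f => \bigcup_(i in D) fv (f i)
  | All x f | Ex x f => fv f `\ x
  end.

(* A formula without free variables; its subformulas then automatically have
   only finitely many free variables. *)
Record sentence (tau : vocabulary) := Sentence {
  sentence_formula :> formula tau;
  sentence_closed : fv sentence_formula = set0
}.

(* Structures whose universe [dom] is a subset of an ambient type [U], so that
   inclusions of structures and unions of chains are literal ones. *)
Record structure (tau : vocabulary) (U : Type) := Structure {
  dom : set U;
  rel_int : forall r : rel_sym tau, (arity r).-tuple U -> Prop;
  const_int : const_sym tau -> U;
  dom_nonempty : dom !=set0;
  rel_int_dom : forall r (a : (arity r).-tuple U),
    rel_int a -> forall i, dom (tnth a i);
  const_int_dom : forall c, dom (const_int c)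
}.

Definition eval (tau : vocabulary) (U : Type) (M : structure tau U)
    (v : nat -> U) (t : term tau) : U :=
  match t with Var x => v x | Const c => const_int M c end.

Definition update (U : Type) (v : nat -> U) (x : nat) (a : U) : nat -> U :=
  fun y => if y == x then a else v y.

Fixpoint sat (tau : vocabulary) (U : Type) (M : structure tau U)
    (v : nat -> U) (f : formula tau) : Prop :=
  match f with
  | Eq s t => eval M v s = eval M v t
  | Rel r ts => rel_int M (map_tuple (eval M v) ts)
  | Neg f => ~ sat M v f
  | And f g => sat M v f /\ sat M v g
  | Or f g => sat M v f \/ sat M v g
  | Imp f g => sat M v f -> sat M v g
  | Conj _ D f => forall i, D i -> sat M v (f i)
  | Disj _ D f => exists i, D i /\ sat M v (f i)
  | All x f => forall a, dom M a -> sat M (update v x a) f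
  | Ex x f => exists a, dom M a /\ sat M (update v x a) f
  end.

Definition models (tau : vocabulary) (U : Type) (M : structure tau U)
    (s : sentence tau) : Prop :=
  forall v : nat -> U, (forall x, dom M (v x)) -> sat M v s.

Definition substructure (tau : vocabulary) (U : Type) (M N : structure tau U) :=
  [/\ dom M `<=` dom N,
      (forall c, const_int M c = const_int N c) &
      forall r (a : (arity r).-tuple U), (forall i, dom M (tnth a i)) ->
        (rel_int M a <-> rel_int N a)].

Definition isomorphism (tau : vocabulary) (U U' : Type) (M : structure tau U)
    (M' : structure tau U') (f : U -> U') : Prop :=
  [/\ set_bij (dom M) (dom M') f,
      (forall c, f (const_int M c) = const_int M' c) &
      forall r (a : (arity r).-tuple U), (forall i, dom M (tnth a i)) ->
        (rel_int M a <-> rel_int M' (map_tuple f a))].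

Section Union.
Context (tau : vocabulary) (U I : Type) (i0 : I) (M : I -> structure tau U).

Let udom : set U := \bigcup_i dom (M i).
Let urel (r : rel_sym tau) (a : (arity r).-tuple U) :=
  exists i, rel_int (M i) a.

Let udom_nonempty : udom !=set0.
Proof. by have [a Ma] := dom_nonempty (M i0); exists a, i0. Qed.

Let urel_dom r (a : (arity r).-tuple U) :
  urel a -> forall i, udom (tnth a i).
Proof. by move=> [i Ma] j; exists i => //; apply: rel_int_dom Ma j. Qed.

Let uconst_dom c : udom (const_int (M i0) c).
Proof. by exists i0 => //; apply: const_int_dom. Qed.

(* The union of a chain; its constants are those of any member, here [M i0]. *)
Definition union_structure : structure tau U :=
  Structure udom_nonempty urel_dom uconst_dom.
End Union.

Definition structure_class (tau : vocabulary) :=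
  forall U : Type, structure tau U -> Prop.

Definition structure_relation (tau : vocabulary) :=
  forall U : Type, structure tau U -> structure tau U -> Prop.

(* A chain indexed by a limit ordinal, the latter given as a well-order. *)
Definition limit_order (I : Type) (R : rel I) : Prop :=
  [/\ well_order R, (exists i : I, True) & forall i, exists j, R i j /\ i <> j].

Definition increasing_chain (tau : vocabulary) (prec : structure_relation tau)
    (U I : Type) (R : rel I) (M : I -> structure tau U) : Prop :=
  limit_order R /\ forall i j, R i j -> prec U (M i) (M j).

(* As usual, Loewenheim-Skolem numbers are taken to be infinite and at least
   the size of the vocabulary. *)
Definition LS_property (tau : vocabulary) (K : structure_class tau)
    (prec : structure_relation tau) (kappa : Type) : Prop :=
  [/\ infinite_set [set: kappa],
      ([set: rel_sym tau + const_sym tau] #<= [set: kappa])%card &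
      forall (U : Type) (N : structure tau U) (X : set U),
        K U N -> X `<=` dom N ->
        exists M : structure tau U,
          [/\ prec U M N, X `<=` dom M &
              (dom M #<= [set: X + kappa])%card]].

Record is_AEC (tau : vocabulary) (K : structure_class tau)
    (prec : structure_relation tau) : Prop := IsAEC {
  aec_field : forall (U : Type) (M N : structure tau U),
    prec U M N -> K U M /\ K U N;
  aec_refl : forall (U : Type) (M : structure tau U), K U M -> prec U M M;
  aec_anti : forall (U : Type) (M N : structure tau U),
    prec U M N -> prec U N M -> M = N;
  aec_trans : forall (U : Type) (M N P : structure tau U),
    prec U M N -> prec U N P -> prec U M P;
  aec_sub : forall (U : Type) (M N : structure tau U),
    prec U M N -> substructure M N;
  aec_iso : forall (U U' : Type) (M : structure tau U) (M' : structure tau U')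
      (f : U -> U'),
    isomorphism M M' f -> K U M -> K U' M';
  aec_iso_prec : forall (U U' : Type) (M N : structure tau U)
      (M' N' : structure tau U') (f : U -> U'),
    isomorphism N N' f -> isomorphism M M' f ->
    prec U M N -> prec U' M' N';
  aec_coherence : forall (U : Type) (M N P : structure tau U),
    prec U M P -> prec U N P -> substructure M N -> prec U M N;
  aec_union : forall (U I : Type) (R : rel I) (i0 : I)
      (M : I -> structure tau U),
    increasing_chain prec R M ->
    [/\ K U (union_structure i0 M),
        (forall i, prec U (M i) (union_structure i0 M)) &
        forall N : structure tau U, (forall i, prec U (M i) N) ->
          prec U (union_structure i0 M) N];
  aec_LS : exists kappa : Type, LS_property K prec kappa
}.

Module Psi.
Section Psi.
Context (alpha : countable_ordinal).

(* The ordinals [<= alpha] and the ordinals [<= alpha + 1]. *)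
Definition index := osucc alpha.
Definition index1 := osucc index.

Definition below (b : alpha) : index := Some b.
Definition itself : index := None.
Definition incl (b : index) : index1 := Some b.
Definition top : index1 := None.

(* The ordinals [beta] with [1 <= beta <= alpha + 1]. *)
Definition pos_index := {b : index1 | ~~ is_zero b}.

Lemma top_pos : ~~ is_zero top.
Proof. by apply/negP => /asboolP/(_ (incl itself)). Qed.

Definition pos_top : pos_index := Sub top top_pos.

Inductive psi_rel :=
| RL of index1
| RS | RV | RT
| Rlt of pos_index
| RF of index
| RG.

Definition psi_arity (r : psi_rel) : nat :=
  match r with
  | RL _ => 1
  | RS | RV | RT | Rlt _ => 2
  | RF _ | RG => 3
  end.

Inductive psi_const := Zero | C of nat.

Definition psi_voc : vocabulary := Vocabulary psi_arity psi_const.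

Local Notation tm := (term psi_voc).
Local Notation fm := (formula psi_voc).

Definition L (b : index1) (s : tm) : fm := @Rel psi_voc (RL b) [tuple s].
Definition S (s t : tm) : fm := @Rel psi_voc RS [tuple s; t].
Definition V (s t : tm) : fm := @Rel psi_voc RV [tuple s; t].
Definition T (s t : tm) : fm := @Rel psi_voc RT [tuple s; t].
Definition lt (b : pos_index) (s t : tm) : fm :=
  @Rel psi_voc (Rlt b) [tuple s; t].
Definition F (b : index) (s t u : tm) : fm :=
  @Rel psi_voc (RF b) [tuple s; t; u].
Definition G (s t u : tm) : fm := @Rel psi_voc RG [tuple s; t; u].

Local Notation zero := (@Const psi_voc Zero).
Local Notation c n := (@Const psi_voc (C n)).
Local Notation "s ≡ t" := (Eq s t) (at level 70).
Local Notation "¬ f" := (Neg f) (at level 75, right associativity).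
Local Notation "f ∧ g" := (And f g) (at level 80, right associativity).
Local Notation "f ∨ g" := (Or f g) (at level 85, right associativity).
Local Notation "f ⇒ g" := (Imp f g) (at level 90, right associativity).
Local Notation "f ⇔ g" := (And (Imp f g) (Imp g f)) (at level 95).
Local Notation "∀ x .. y , f" := (All x .. (All y f) ..)
  (at level 200, x constr at level 8, y constr at level 8, right associativity).
Local Notation "∃ x .. y , f" := (Ex x .. (Ex y f) ..)
  (at level 200, x constr at level 8, y constr at level 8, right associativity).

(* Pairwise distinct variables.  The auxiliary formulas below bind only
   [p], [q] and [r]; to avoid capture they are applied to terms and formulas
   in which these do not occur free, apart from the ones passed explicitly. *)
Local Notation x := 0. Local Notation y := 1. Local Notation z := 2.
Local Notation a := 3. Local Notation b := 4.
Local Notation p := 5. Local Notation q := 6. Local Notation r := 7.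
Local Coercion var (n : nat) : tm := Var n.

Definition le (d : pos_index) (s t : tm) : fm := lt d s t ∨ s ≡ t.

Definition level (s : tm) : fm := L top s.
Definition level_lt (s t : tm) : fm := lt pos_top s t.
Definition level_le (s t : tm) : fm := le pos_top s t.
Definition level_max (s : tm) : fm :=
  level s ∧ ∀ p, level p ⇒ level_le p s.
Definition level_succ (s : tm) : fm := ∃ p, S p s.
Definition level_limit (s : tm) : fm :=
  level s ∧ ¬ (s ≡ zero) ∧ ¬ level_succ s.

Definition node (s : tm) : fm := ∃ p, level p ∧ V p s.

Definition linear_order (d : pos_index) : fm :=
  (∀ x, L (val d) x ⇒ ¬ lt d x x) ∧
  (∀ x y z, L (val d) x ∧ L (val d) y ∧ L (val d) z ⇒
     lt d x y ∧ lt d y z ⇒ lt d x z) ∧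
  (∀ x y, L (val d) x ∧ L (val d) y ⇒ lt d x y ∨ x ≡ y ∨ lt d y x).

Definition surjection (A B : tm -> fm) (R : tm -> tm -> fm) : fm :=
  (∀ p q, R p q ⇒ A p ∧ B q) ∧
  (∀ p, A p ⇒ ∃ q, R p q) ∧
  (∀ p q r, R p q ∧ R p r ⇒ q ≡ r) ∧
  (∀ q, B q ⇒ ∃ p, R p q).

Definition psi_a : fm :=
  linear_order pos_top ∧
  (level zero ∧ ∀ x, level x ⇒ level_le zero x) ∧
  (∀ x, level x ∧ ¬ level_max x ⇒ ∃ y, S x y) ∧
  (∀ x y, S x y ⇔
     (level x ∧ level y ∧ level_lt x y ∧
      ¬ ∃ z, level z ∧ level_lt x z ∧ level_lt z y)) ∧
  (∀ x, level_max x ⇒ ¬ level_succ x).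

Definition psi_b : fm :=
  (Conj setT (fun d : index1 => ∀ a x, level a ∧ V a x ⇒ ¬ L d x)) ∧
  (∀ a b x, level a ∧ level b ∧ V a x ∧ V b x ⇒ a ≡ b) ∧
  (∀ x, Disj setT (fun d : index1 => L d x) ∨ node x).

(* "Tree ordering" is rendered by its first-order part: a strict partial order
   in which the predecessors of a node are pairwise comparable.  "Pruned" is
   rendered as: every node has an extension at each higher level. *)
Definition psi_c : fm :=
  (∀ x y, T x y ⇒ node x ∧ node y) ∧
  (∀ x, ¬ T x x) ∧
  (∀ x y z, T x y ∧ T y z ⇒ T x z) ∧
  (∀ x y z, T x z ∧ T y z ⇒ T x y ∨ x ≡ y ∨ T y x) ∧
  (∀ a b x y, level a ∧ level b ∧ V a x ∧ V b y ∧ T x y ⇒ level_lt a b) ∧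
  (∀ a b y, level a ∧ level b ∧ V a y ∧ level_lt b a ⇒ ∃ x, V b x ∧ T x y) ∧
  (∀ a x y, level_limit a ∧ V a x ∧ V a y ∧ (∀ z, T z x ⇔ T z y) ⇒ x ≡ y) ∧
  (∀ a b x, level a ∧ level b ∧ V a x ∧ level_lt a b ⇒ ∃ y, V b y ∧ T x y).

(* The second conjunct, left implicit in the usual presentation, is what makes
   [L_0] countably infinite. *)
Definition psi_d : fm :=
  Conj (fun d : index1 => is_zero d)
    (fun d => ∀ x, L d x ⇔ Disj setT (fun n : nat => x ≡ c n)) ∧
  Conj (fun nk : nat * nat => nk.1 != nk.2) (fun nk => ¬ (c nk.1 ≡ c nk.2)).

Definition psi_e : fm :=
  Conj (fun d : pos_index => val d != top) linear_order ∧
  Conj (fun d : index1 => is_limit d)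
    (fun d => ∀ x, L d x ⇔ Disj (fun e : index1 => olt e d) (fun e => L e x)).

Definition succ_pairs : set (alpha * pos_index) :=
  [set be | is_succ (incl (below be.1)) (val be.2)].

Definition psi_f : fm :=
  Conj succ_pairs (fun be : alpha * pos_index =>
    ∀ x, L (val be.2) x ⇒
      surjection (L (incl (below be.1)))
        (fun t => L (val be.2) t ∧ le be.2 t x)
        (F (below be.1) x)).

Definition psi_g : fm :=
  ∀ x, level x ∧ ¬ level_max x ⇒
    surjection (L (incl itself)) (fun t => level t ∧ level_le t x) (F itself x) ∧
    surjection (L (incl itself)) (V x) (G x).

Definition psi_formula : fm :=
  psi_a ∧ psi_b ∧ psi_c ∧ psi_d ∧ psi_e ∧ psi_f ∧ psi_g.

Section Closed.
Implicit Types s t u : tm.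

Lemma tnth1_fv s n :
  (exists i, term_fv (tnth [tuple s] i) n) <-> term_fv s n.
Proof.
split=> [[i]|sn]; last by exists ord0.
by rewrite (tnth_nth s) /=; case: i => [[|]].
Qed.

Lemma tnth2_fv s t n :
  (exists i, term_fv (tnth [tuple s; t] i) n) <-> term_fv s n \/ term_fv t n.
Proof.
split=> [[i]|[]].
- by rewrite (tnth_nth s) /=; case: i => [[|[|]]] //=; [left|right].
- by exists (inord 0); rewrite (tnth_nth s) /= inordK.
- by exists (inord 1); rewrite (tnth_nth s) /= inordK.
Qed.

Lemma tnth3_fv s t u n :
  (exists i, term_fv (tnth [tuple s; t; u] i) n) <->
  term_fv s n \/ term_fv t n \/ term_fv u n.
Proof.
split=> [[i]|[|[]]].
- rewrite (tnth_nth s) /=; case: i => [[|[|[|]]]] //=.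
  + by left.
  + by right; left.
  + by right; right.
- by exists (inord 0); rewrite (tnth_nth s) /= inordK.
- by exists (inord 1); rewrite (tnth_nth s) /= inordK.
- by exists (inord 2); rewrite (tnth_nth s) /= inordK.
Qed.

End Closed.

Lemma psi_closed : fv psi_formula = set0.
Proof.
have kill n : ~ fv psi_formula n.
  rewrite /psi_formula /=.
  by repeat match goal with
  | |- ~ _ => intro
  | H : (_ `|` _) _ |- _ => destruct H
  | H : _ \/ _ |- _ => destruct H
  | H : _ /\ _ |- _ => destruct H
  | H : False |- _ => destruct H
  | H : (_ `\ _) _ |- _ => destruct H
  | H : (\bigcup_(_ in _) _) _ |- _ => destruct H
  | H : ex2 _ _ |- _ => destruct H
  | H : set0 _ |- _ => destruct H
  | H : [set _] _ |- _ => rewrite /= in H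
  | H : ?P, H' : ~ ?P |- _ => case: (H' H)
  | H : [set k | exists i, _] _ |- _ => rewrite /= in H
  | H : exists i, term_fv (tnth [tuple _] i) _ |- _ => apply tnth1_fv in H; simpl in H
  | H : exists i, term_fv (tnth [tuple _; _] i) _ |- _ => apply tnth2_fv in H; simpl in H
  | H : exists i, term_fv (tnth [tuple _; _; _] i) _ |- _ => apply tnth3_fv in H; simpl in H
  end.
by apply/seteqP; split=> // n /kill.
Qed.

Definition psi : sentence psi_voc := Sentence psi_closed.

End Psi.
End Psi.

Definition K (alpha : countable_ordinal) : structure_class (Psi.psi_voc alpha) :=
  fun U M => models M (Psi.psi alpha).

Definition precK (alpha : countable_ordinal) :
    structure_relation (Psi.psi_voc alpha) :=
  fun U M N => [/\ K M, K N & substructure M N].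

(* Main.v *)
From Stdlib Require List.
Require Import Defs.
From mathcomp Require Import all_boot all_classical.

(** Every axiom of an abstract elementary class except closure under unions of
    chains and the Loewenheim-Skolem property is immediate once truth is known
    to be invariant under isomorphism ([sat_isomorphism]), because the strong
    substructure relation is the plain substructure relation between models of
    one sentence.

    Unions.  Read from the outside, each requirement of the sentence consists
    of a block of universal quantifiers followed by a block of existential ones:
    a premise such as being a limit level says that something does not exist,
    so that, as a premise, it contributes an existential quantifier to the
    conclusion.  Sentences of this shape are preserved by unions of chains.
    Infinite conjunctions and disjunctions are harmless in most places, but not
    in all: a chain may satisfy each of infinitely many existential statements
    only at later and later stages.  The predicate [two_quantifier] is a
    syntactic class of infinitary formulas that excludes such combinations,
    [models_union] proves preservation for the whole class, and that the
    sentence belongs to it is checked by computation ([psi_two_quantifier]).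

    Small models.  This is the downward Loewenheim-Skolem theorem for infinitary
    sentences ([downward_Loewenheim_Skolem]).  A formula built with countable
    connectives has countably many subformulas, hence countably many Skolem
    functions, and in a sentence each of them depends on finitely many
    variables only.  So the closure of a set [X] under them is no larger than
    the set of finite sequences over the disjoint sum of [X] and [nat]
    ([small_closure]), and by the Tarski-Vaught argument ([sat_skolem_closed])
    it satisfies the same sentence.

    The cardinality bound rests on the fact that an infinite set is equipotent
    with its square ([card_square]), hence with the set of its finite
    sequences ([card_seq]). *)

Set Implicit Arguments.
Unset Strict Implicit.
Unset Printing Implicit Defensive.

Local Open Scope classical_set_scope.
Local Open Scope card_scope.

(** * Squares of infinite cardinals *)

Lemma card_leTP (T U : Type) :
  [set: T] #<= [set: U] <-> exists f : T -> U, injective f.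
Proof.
split=> [|[f fI]].
  move=> /card_leP[f]; exists (fun x => val (f (to_setT x))) => x y /val_inj.
  by move=> /(@inj _ _ _ f) xy; have := xy (mem_set I) (mem_set I); case.
apply: (@card_le_trans _ _ _ (range f)); last exact: card_leT.
by rewrite (card_le_eqr (inj_card_eq _)) // => x y _ _; apply: fI.
Qed.

Lemma injective_cancel (A B : Type) (a0 : A) (i : A -> B) :
  injective i -> exists q : B -> A, cancel i q.
Proof.
move=> iI.
have /choice[q qP] : forall b, exists a, forall a', i a' = b -> a' = a.
  move=> b; have [[a ia]|no] := pselect (exists a, i a = b).
    by exists a => a' ia'; apply: iI; rewrite ia.
  by exists a0 => a' ia'; case: no; exists a'.
by exists q => a; rewrite -(qP (i a) a).
Qed.

Section PartialInjections.
Context (T U : Type).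
Implicit Types R : set (T * U).

Definition partial_injection (A : set T) (B : set U) R :=
  [/\ forall x y, R (x, y) -> A x /\ B y,
      forall x y y', R (x, y) -> R (x, y') -> y = y' &
      forall x x' y, R (x, y) -> R (x', y) -> x = x'].

Lemma partial_injection_bigcup A B (C : set (set (T * U))) :
  C `<=` partial_injection A B -> total_on C subset ->
  partial_injection A B (\bigcup_(R in C) R).
Proof.
move=> CP Ct; split=> [x y [R CR]|x y y' [R CR Rxy] [R' CR' Rxy']|
                       x x' y [R CR Rxy] [R' CR' Rxy']].
- by have [h _ _] := CP _ CR; apply: h.
- have [le|le] := Ct _ _ CR CR'.
  + by have [_ h _] := CP _ CR'; apply: h (le _ Rxy) Rxy'.
  + by have [_ h _] := CP _ CR; apply: h Rxy (le _ Rxy').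
- have [le|le] := Ct _ _ CR CR'.
  + by have [_ _ h] := CP _ CR'; apply: h (le _ Rxy) Rxy'.
  + by have [_ _ h] := CP _ CR; apply: h Rxy (le _ Rxy').
Qed.

(** A maximal partial injection exhausts one of the two sides. *)
Lemma injection_total (A : set T) (B : set U) (t0 : T) (u0 : U) :
  (exists2 f : T -> U, set_fun A B f & set_inj A f) \/
  (exists2 g : U -> T, set_fun B A g & set_inj B g).
Proof.
have [R [[RAB Rfun Rinj] Rmax]] :=
  Zorn_bigcup (@partial_injection_bigcup A B).
have [tot|ntot] := pselect (forall x, A x -> exists y, R (x, y)).
  left; have /choice[f fP] : forall x, exists y, A x -> R (x, y).
    move=> x; have [/tot[y Ry]|nA] := pselect (A x); first by exists y.
    by exists u0 => /nA.
  exists f => [x /fP/RAB[]//|x x' /set_mem/fP fx /set_mem/fP fx' e].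
  by apply: Rinj fx _; rewrite e.
have [sur|nsur] := pselect (forall y, B y -> exists x, R (x, y)).
  right; have /choice[g gP] : forall y, exists x, B y -> R (x, y).
    move=> y; have [/sur[x Rx]|nB] := pselect (B y); first by exists x.
    by exists t0 => /nB.
  exists g => [y /gP/RAB[]//|y y' /set_mem/gP gy /set_mem/gP gy' e].
  by apply: Rfun gy _; rewrite e.
have /existsNP[a /not_implyP[Aa /forallNP Na]] := ntot.
have /existsNP[b /not_implyP[Bb /forallNP Nb]] := nsur.
exfalso; apply: (Rmax (R `|` [set (a, b)])).
  split=> [p Rp|le]; first by left.
  by apply: (Na b); apply: le; right.
split=> [x y [/RAB//|[-> ->]]//|x y y'|x x' y].
- move=> [Rxy|[xa ->]] [Rxy'|[xa' ->]] //; first exact: Rfun Rxy Rxy'.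
    by case: (Na y); rewrite -xa'.
  by case: (Na y'); rewrite -xa.
- move=> [Rxy|[-> yb]] [Rxy'|[-> yb']] //; first exact: Rinj Rxy Rxy'.
    by case: (Nb x); rewrite -yb'.
  by case: (Nb x'); rewrite -yb.
Qed.

End PartialInjections.

Section Square.
Context (T : Type).
Implicit Types (B : set T) (G : set (T * T * T)).

(** The coordinate projection of the domain of [G], which is meant to be a
    square; the diagonal suffices to recover it. *)
Definition base G : set T := [set x | exists y, G (x, x, y)].

(** [G] is the graph of an injection of [base G * base G] into [base G]. *)
Definition pairing_graph G :=
  [/\ forall x y, base G x -> base G y -> exists z, G (x, y, z),
      forall x y z, G (x, y, z) -> [/\ base G x, base G y & base G z],
      forall p z z', G (p, z) -> G (p, z') -> z = z' &
      forall p p' z, G (p, z) -> G (p', z) -> p = p'].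

Lemma base_subset G G' : G `<=` G' -> base G `<=` base G'.
Proof. by move=> le x [y /le]; exists y. Qed.

(** Two points of the union of the bases belong to one base, because the graphs
    form a chain; so the union is defined on all pairs. *)
Lemma pairing_graph_bigcup (C : set (set (T * T * T))) :
  (forall G, C G -> pairing_graph G) -> total_on C subset ->
  pairing_graph (\bigcup_(G in C) G).
Proof.
move=> CP Ct.
have sub G : C G -> G `<=` \bigcup_(G in C) G by move=> CG p; exists G.
have joint G G' : C G -> C G' -> exists H, [/\ C H, G `<=` H & G' `<=` H].
  move=> CG CG'; have [le|le] := Ct _ _ CG CG'.
    by exists G'; split=> // p.
  by exists G; split=> // p.
split=> [x y [z [G CG Gx]] [z' [G' CG' Gy]]|x y z [G CG /[dup] Gp]|
         p z z' [G CG Gp] [G' CG' Gp']|p p' z [G CG Gp] [G' CG' Gp']].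
- have [H [CH le le']] := joint _ _ CG CG'.
  have [tot _ _ _] := CP _ CH.
  have [||u Hu] := tot x y; first by exists z; apply: le.
    by exists z'; apply: le'.
  by exists u, H.
- have [_ rng _ _] := CP _ CG.
  by move=> /rng[]; split; apply: (base_subset (sub _ CG)).
- have [H [CH le le']] := joint _ _ CG CG'.
  by have [_ _ h _] := CP _ CH; apply: h (le _ Gp) (le' _ Gp').
- have [H [CH le le']] := joint _ _ CG CG'.
  by have [_ _ _ h] := CP _ CH; apply: h (le _ Gp) (le' _ Gp').
Qed.

Lemma pairing_graph_fun (t0 : T) G : pairing_graph G ->
  exists j : T * T -> T,
    [/\ forall x y, base G x -> base G y -> base G (j (x, y)),
        forall x y z, G (x, y, z) <-> [/\ base G x, base G y & z = j (x, y)] &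
        forall x y x' y', base G x -> base G y -> base G x' -> base G y' ->
          j (x, y) = j (x', y') -> x = x' /\ y = y'].
Proof.
move=> [tot rng fct inj].
have /choice[j jP] : forall p, exists z, base G p.1 -> base G p.2 -> G (p, z).
  move=> [x y] /=; have [[Gx Gy]|no] := pselect (base G x /\ base G y).
    by have [z Gz] := tot x y Gx Gy; exists z.
  by exists t0 => Gx Gy; case: no.
exists j; split=> [x y Gx Gy|x y z|x y x' y' Gx Gy Gx' Gy' e].
- by have [] := rng _ _ _ (jP (x, y) Gx Gy).
- split=> [Gz|[Gx Gy ->]]; last exact: (jP (x, y)).
  have [Gx Gy _] := rng _ _ _ Gz; split=> //.
  exact: fct Gz (jP (x, y) Gx Gy).
- have := jP (x', y') Gx' Gy'; rewrite -e => h.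
  by have [-> ->] := inj _ _ _ (jP (x, y) Gx Gy) h.
Qed.

(** If the base of [G] embeds into its own complement, it can be doubled: the
    new pairs are coded by elements of the base, via [j] and the tags [b0] and
    [b1], and the codes are then moved outside of the base. *)
Lemma pairing_graph_extend G (b0 b1 : T) (e : T -> T) :
  pairing_graph G -> base G b0 -> base G b1 -> b0 <> b1 ->
  set_fun (base G) (~` base G) e -> set_inj (base G) e ->
  exists2 G', G `<` G' & pairing_graph G'.
Proof.
move=> PG Gb0 Gb1 b01 eC eI; set B := base G.
have [j [jB jP jI]] := pairing_graph_fun b0 PG.
pose B' := B `|` e @` B.
have /choice[d dP] : forall u, exists v, 
    (B u -> v = j (b0, u)) /\ (forall b, B b -> u = e b -> v = j (b1, b)).
  move=> u; have [Bu|nBu] := pselect (B u).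
    by exists (j (b0, u)); split=> // b Bb ue; case: (eC b Bb); rewrite -ue.
  have [[b Bb be]|no] := pselect ((e @` B) u).
    exists (j (b1, b)); split=> // b' Bb' ue.
    by rewrite (eI b b') ?inE // be.
  by exists u; split=> // b Bb ue; case: no; exists b.
have dB u : B' u -> B (d u).
  move=> [Bu|[b Bb be]]; first by rewrite (dP u).1 //; apply: jB.
  by rewrite ((dP u).2 b) //; apply: jB.
have dI u v : B' u -> B' v -> d u = d v -> u = v.
  move=> [Bu|[b Bb be]] [Bv|[c Bc ce]].
  - by rewrite (dP u).1 ?(dP v).1 // => /jI[].
  - by rewrite (dP u).1 // ((dP v).2 c) // => /jI[].
  - by rewrite ((dP u).2 b) // (dP v).1 // => /jI[] // /esym.
  - by rewrite ((dP u).2 b) // ((dP v).2 c) // => /jI[] // _ bc; rewrite -be bc.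
pose G' : set (T * T * T) := G `|`
  [set p | [/\ B' p.1.1, B' p.1.2, ~ (B p.1.1 /\ B p.1.2) &
               p.2 = e (j (d p.1.1, d p.1.2))]].
have G'B' : base G' = B'.
  apply/seteqP; split=> [u [z [Gu|[]//]]|u [[z Gu]|eu]].
  - by left; exists z.
  - by exists z; left.
  - exists (e (j (d u, d u))); right; split=> //=; try by right.
    by by case: eu => b Bb <- [/(eC b Bb)].
have jd u v : B' u -> B' v -> B (j (d u, d v)).
  by move=> *; apply: jB; apply: dB.
exists G'.
  split=> [p Gp|le]; first by left.
  have B'e : B' (e b0) by right; exists b0.
  have /le/jP[/(eC b0 Gb0)] // : G' (e b0, e b0, e (j (d (e b0), d (e b0)))).
  by right; split=> //= -[/(eC b0 Gb0)].
split; rewrite ?G'B'.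
- move=> x y B'x B'y; have [[Bx By]|nB] := pselect (B x /\ B y).
    by exists (j (x, y)); left; apply/jP.
  by exists (e (j (d x, d y))); right.
- move=> x y z [/jP[Bx By ->]|/= [B'x B'y _ ->]].
    by split; left => //; apply: jB.
  by split=> //; right; exists (j (d x, d y)) => //; apply: jd.
- move=> [x y] z z' [/jP[Bx By ->]|/= [B'x B'y nB ->]].
    by move=> [/jP[_ _ ->]|/= [_ _ []]].
  by move=> [/jP[Bx By _]|/= [_ _ _ ->]] //; case: nB.
- move=> [x y] [x' y'] z [/jP[Bx By ->]|/= [B'x B'y nB ->]].
    move=> [/jP[Bx' By' /jI[]// -> -> //]|/= [Bx' By' _ ee]].
    by case: (eC (j (d x', d y'))); [apply: jd | rewrite -ee; apply: jB].
  move=> [/jP[Bx' By' ee]|/= [Bx' By' _ ee]].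
    by case: (eC (j (d x, d y))); [apply: jd | rewrite ee; apply: jB].
  have /jI[] : j (d x, d y) = j (d x', d y').
  - by apply: eI; rewrite ?inE; try apply: jd.
  - exact: dB.
  - exact: dB.
  - exact: dB.
  - exact: dB.
  by move=> /dI -> // /dI ->.
Qed.

(** A maximal pairing graph [G] above a countable one has a base that is as
    large as [T].  For if the base embeds into its complement then [G] can be
    extended; otherwise the complement embeds into the base, and [T] embeds into
    the base via two tagged copies, so that the pairing of the base transfers
    to [T]. *)
Lemma card_square : infinite_set [set: T] -> [set: T * T] #<= [set: T].
Proof.
move=> /infiniteP/card_leTP[n nI].
pose G0 : set (T * T * T) :=
  [set p | exists i k : nat, p = (n i, n k, n (pickle (i, k)))].
have G0B : base G0 = range n.
  apply/seteqP; split=> [x [y [i [k [-> _ _]]]]|x [i _ <-]]; first by exists i.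
  by exists (n (pickle (i, i))), i, i.
have PG0 : pairing_graph G0.
  split; rewrite ?G0B.
  - by move=> _ _ [i _ <-] [k _ <-]; exists (n (pickle (i, k))), i, k.
  - by move=> x y z [i [k [-> -> ->]]].
  - by move=> p z z' [i [k [-> ->]]] [i' [k' [/nI -> /nI -> ->]]].
  - move=> p p' z [i [k [-> ->]]] [i' [k' [-> /nI]]].
    by move=> /(pcan_inj pickleK) [-> ->].
(* The empty graph is admitted only so that the empty chain has a bound. *)
have [C CP Ct|G [PG Gmax]] :=
  @Zorn_bigcup _ [set G | G = set0 \/ pairing_graph G /\ G0 `<=` G].
  pose C' := [set G | C G /\ G <> set0].
  have -> : \bigcup_(G in C) G = \bigcup_(G in C') G.
    apply/seteqP; split=> [p [G CG Gp]|p [G [CG _] Gp]]; exists G => //.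
    by split=> // G0e; rewrite G0e in Gp.
  have C'P G : C' G -> pairing_graph G /\ G0 `<=` G by move=> [/CP[]].
  have [[G C'G]|no] := pselect (exists G, C' G).
    right; split; last by move=> p /(C'P _ C'G).2 Gp; exists G.
    apply: pairing_graph_bigcup => [H /C'P[]//|H H' [CH _] [CH' _]].
    exact: Ct.
  by left; apply/seteqP; split=> // p [G C'G]; case: no; exists G.
have {PG} [PG G0G] : pairing_graph G /\ G0 `<=` G.
  case: PG => // G0e; case: (Gmax G0); last by right; split=> // p.
  rewrite G0e; split=> // /(_ (n 0, n 0, n (pickle (0, 0)))).
  by apply; exists 0, 0.
have b i : base G (n i).
  by apply: (base_subset G0G); rewrite G0B; exists i.
have n01 : n 0 <> n 1 by move=> /nI.
have [[e eC eI]|[e eB eI]] :=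
    injection_total (base G) (~` base G) (n 0) (n 0).
  have [G' GG' PG'] := pairing_graph_extend PG (b 0) (b 1) n01 eC eI.
  case: (Gmax G' GG'); right; split=> //.
  exact: subset_trans G0G (properW GG').
have [j [jB _ jI]] := pairing_graph_fun (n 0) PG.
pose d u := if pselect (base G u) then j (n 0, u) else j (n 1, e u).
have dB u : base G (d u).
  by rewrite /d; case: pselect => Bu; apply: jB => //; apply: eB.
have dI : injective d.
  move=> u v; rewrite /d; case: pselect => Bu; case: pselect => Bv.
  - by move=> /jI[].
  - by move=> /jI[] //; apply: eB.
  - by move=> /jI[] //; [apply: eB | move=> /esym].
  - move=> /jI[] //; [exact: eB | exact: eB | move=> _ ee].
    by apply: eI ee; rewrite inE.
apply/card_leTP; exists (fun p => j (d p.1, d p.2)) => -[x y] [x' y'] /=.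
by move=> /jI[] // /dI -> /dI ->.
Qed.

End Square.

(** A sequence is coded by iterated pairing.  The first component [n 0] or [n 1]
    tells the empty sequence from a nonempty one. *)
Lemma card_seq (T : Type) :
  infinite_set [set: T] -> [set: seq T] #<= [set: T].
Proof.
move=> Tinf; have /card_leTP[j jI] := card_square Tinf.
have /infiniteP/card_leTP[n nI] := Tinf.
pose code := foldr (fun x c => j (n 1, j (x, c))) (j (n 0, n 0)).
apply/card_leTP; exists code; elim=> [|x s IH] [|y t] //= /jI[].
- by move=> /nI.
- by move=> /nI.
- by move=> /jI[-> /IH ->].
Qed.

(** * Truth, substructures and isomorphisms *)

Section Truth.
Context (tau : vocabulary).
Implicit Types (f g : formula tau) (t : term tau).

Lemma eq_eval (U : Type) (M : structure tau U) (v w : nat -> U) t :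
  (forall x, term_fv t x -> v x = w x) -> eval M v t = eval M w t.
Proof. by case: t => //= x; apply. Qed.

Lemma eq_sat (U : Type) (M : structure tau U) f (v w : nat -> U) :
  (forall x, fv f x -> v x = w x) -> sat M v f <-> sat M w f.
Proof.
elim: f v w => [s t|r ts|f IH|f IHf g IHg|f IHf g IHg|f IHf g IHg|
                I D f IH|I D f IH|x f IH|x f IH] v w /= vw.
- rewrite (@eq_eval _ M v w s) ?(@eq_eval _ M v w t) //.
  + by move=> x xt; apply: vw; right.
  + by move=> x xs; apply: vw; left.
- suff -> : map_tuple (eval M v) ts = map_tuple (eval M w) ts by [].
  apply: eq_from_tnth => i; rewrite !tnth_map.
  by apply: eq_eval => x xi; apply: vw; exists i.
- by rewrite (IH v w).
- by rewrite (IHf v w) ?(IHg v w) // => x fx; apply: vw; [right|left].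
- by rewrite (IHf v w) ?(IHg v w) // => x fx; apply: vw; [right|left].
- by rewrite (IHf v w) ?(IHg v w) // => x fx; apply: vw; [right|left].
- have e i : D i -> sat M v (f i) <-> sat M w (f i).
    by move=> Di; apply: IH => x fx; apply: vw; exists i.
  by split=> h i Di; apply/(e i Di)/h.
- have e i : D i -> sat M v (f i) <-> sat M w (f i).
    by move=> Di; apply: IH => x fx; apply: vw; exists i.
  by split=> -[i [Di h]]; exists i; split=> //; apply/(e i Di).
- have e a : sat M (update v x a) f <-> sat M (update w x a) f.
    apply: IH => y fy; rewrite /update; case: eqP => // yx.
    by apply: vw; split.
  by split=> h a Ma; apply/e/h.
- have e a : sat M (update v x a) f <-> sat M (update w x a) f.
    apply: IH => y fy; rewrite /update; case: eqP => // yx.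
    by apply: vw; split.
  by split=> -[a [Ma h]]; exists a; split=> //; apply/e.
Qed.

Lemma dom_eval (U : Type) (M : structure tau U) (v : nat -> U) t :
  (forall x, dom M (v x)) -> dom M (eval M v t).
Proof. by case: t => //= c _; apply: const_int_dom. Qed.

Lemma dom_update (U : Type) (A : set U) (v : nat -> U) x a :
  (forall y, A (v y)) -> A a -> forall y, A (update v x a y).
Proof. by move=> Av Aa y; rewrite /update; case: eqP. Qed.

Lemma comp_update (U U' : Type) (h : U -> U') (v : nat -> U) x a :
  h \o update v x a = update (h \o v) x (h a).
Proof. by apply/funext => y; rewrite /update /=; case: eqP. Qed.

Lemma sat_isomorphism (U U' : Type) (M : structure tau U)
    (M' : structure tau U') (h : U -> U') f (v : nat -> U) :
  isomorphism M M' h -> (forall x, dom M (v x)) ->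
  sat M v f <-> sat M' (h \o v) f.
Proof.
move=> [[hM hinj hsurj] hc hr].
have ev t w : h (eval M w t) = eval M' (h \o w) t by case: t => //= c.
elim: f v => [s t|r ts|f IH|f IHf g IHg|f IHf g IHg|f IHf g IHg|
              I D f IH|I D f IH|x f IH|x f IH] v /= Mv.
- rewrite -!ev; split=> [->//|].
  by move=> e; apply: (hinj _ _ _ _ e); rewrite inE; apply: dom_eval.
- rewrite hr; last by move=> i; rewrite tnth_map; apply: dom_eval.
  suff -> : map_tuple h (map_tuple (eval M v) ts) =
            map_tuple (eval M' (h \o v)) ts by [].
  by apply: eq_from_tnth => i; rewrite !tnth_map ev.
- by rewrite IH.
- by rewrite IHf ?IHg.
- by rewrite IHf ?IHg.
- by rewrite IHf ?IHg.
- by split=> k i /k; rewrite IH.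
- by split=> -[i [Di k]]; exists i; split=> //; move: k; rewrite IH.
- split=> k.
    move=> _ /hsurj[a Ma <-]; rewrite -comp_update -IH; first exact: k.
    exact: dom_update.
  move=> a Ma; rewrite IH ?comp_update; first by apply: k; apply: hM.
  exact: dom_update.
- split=> -[a [Ma k]].
    exists (h a); split; first exact: hM.
    by rewrite -comp_update -IH //; apply: dom_update.
  move: Ma k => /hsurj[b Mb <-] k; exists b; split=> //.
  by rewrite IH ?comp_update //; apply: dom_update.
Qed.

End Truth.

Section StructureFacts.
Context (tau : vocabulary).

Lemma substructure_refl (U : Type) (M : structure tau U) : substructure M M.
Proof. by split. Qed.

Lemma substructure_trans (U : Type) (M N P : structure tau U) :
  substructure M N -> substructure N P -> substructure M P.
Proof.
move=> [MN cMN rMN] [NP cNP rNP]; split; first exact: subset_trans NP.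
  by move=> c; rewrite cMN.
by move=> r a Ma; rewrite rMN // rNP // => i; apply: MN.
Qed.

Lemma substructure_anti (U : Type) (M N : structure tau U) :
  substructure M N -> substructure N M -> M = N.
Proof.
move=> [MN cMN rMN] [NM _ _].
case: M N MN NM cMN rMN => [dM rM cM M1 M2 M3] [dN rN cN N1 N2 N3] /= MN NM.
have e : dM = dN by apply/seteqP.
subst dN => /funext e; subst cN => e.
have {}e : rM = rN.
  apply: functional_extensionality_dep => r; apply/funext => a; apply/propext.
  split=> h; first by apply/e => //; apply: M2 h.
  by apply/e => //; apply: N2 h.
subst rN; congr Structure; exact: Prop_irrelevance.
Qed.

Lemma eval_substructure (U : Type) (M N : structure tau U) (v : nat -> U) t :
  substructure M N -> eval M v t = eval N v t.
Proof. by move=> [_ c _]; case: t => //=. Qed.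

Lemma map_eval_substructure (U : Type) (M N : structure tau U) (v : nat -> U)
    n (ts : n.-tuple (term tau)) :
  substructure M N -> map_tuple (eval M v) ts = map_tuple (eval N v) ts.
Proof.
by move=> MN; apply: eq_from_tnth => i; rewrite !tnth_map; apply: eval_substructure.
Qed.

Lemma sat_rel_substructure (U : Type) (M N : structure tau U) (v : nat -> U)
    (r : rel_sym tau) (ts : (arity r).-tuple (term tau)) :
  substructure M N -> (forall x, dom M (v x)) ->
  sat M v (Rel ts) <-> sat N v (Rel ts).
Proof.
move=> MN Mv; rewrite /= -(map_eval_substructure _ _ MN).
case: MN => _ _; apply=> i; rewrite tnth_map; exact: dom_eval.
Qed.

Lemma isomorphism_models (U U' : Type) (M : structure tau U)
    (M' : structure tau U') (h : U -> U') (s : sentence tau) :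
  isomorphism M M' h -> models M s -> models M' s.
Proof.
move=> iso Ms v' M'v'; have [[_ _ hsurj] _ _] := iso.
have /choice[v vP] : forall x, exists a, dom M a /\ h a = v' x.
  by move=> x; have [a Ma e] := hsurj _ (M'v' x); exists a.
have -> : v' = h \o v by apply/funext => x /=; rewrite (vP x).2.
by apply/(sat_isomorphism _ iso); [|apply: Ms] => x; apply: (vP x).1.
Qed.

Lemma isomorphism_substructure (U U' : Type) (M N : structure tau U)
    (M' N' : structure tau U') (h : U -> U') :
  isomorphism N N' h -> isomorphism M M' h ->
  substructure M N -> substructure M' N'.
Proof.
move=> [[hN _ _] cN rN] [[_ _ sM] cM rM] [MN cMN rMN].
have dMN : dom M' `<=` dom N' by move=> _ /sM[a /MN Na <-]; apply: hN.
split=> // [c|r a' M'a']; first by rewrite -cM -cN cMN.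
have /choice[k kP] : forall i, exists a, dom M a /\ h a = tnth a' i.
  by move=> i; have [a Ma e] := sM _ (M'a' i); exists a.
have -> : a' = map_tuple h [tuple k i | i < arity r].
  by apply: eq_from_tnth => i; rewrite tnth_map tnth_mktuple (kP i).2.
have Ma i : dom M (tnth [tuple k i | i < arity r] i).
  by rewrite tnth_mktuple; apply: (kP i).1.
by rewrite -rM // -rN ?rMN // => i; apply: MN.
Qed.

End StructureFacts.

(** * Preservation in directed unions *)

Section Preservation.
Context (tau : vocabulary).

(** A syntactic class of formulas whose truth passes from a substructure to an
    extension ([up = true]) or from an extension to a substructure
    ([up = false]): the existential and the universal formulas, with arbitrary
    infinite connectives. *)
Fixpoint persistent (up : bool) (f : formula tau) : Prop :=
  match f with
  | Eq _ _ | Rel _ _ => True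
  | Neg f => persistent (~~ up) f
  | And f g | Or f g => persistent up f /\ persistent up g
  | Imp f g => persistent (~~ up) f /\ persistent up g
  | Conj _ D f | Disj _ D f => forall i, D i -> persistent up (f i)
  | All _ f => ~~ up /\ persistent up f
  | Ex _ f => up /\ persistent up f
  end.

(** The infinitary counterparts of universal-existential formulas ([pi = true])
    and existential-universal ones ([pi = false]).  A formula of the first kind
    that fails in a directed union fails from some stage on, and one of the
    second kind that holds in the union holds from some stage on; see
    [eventually_sat].  An infinite disjunction of the first kind would need a
    stage that works for all its members at once, and so would an infinite
    conjunction of the second kind.  Therefore the members are then required
    to be persistent, and for them every stage works; likewise for the
    quantifiers. *)
Fixpoint two_quantifier (pi : bool) (f : formula tau) : Prop :=
  match f with
  | Eq _ _ | Rel _ _ => True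
  | Neg f => two_quantifier (~~ pi) f
  | And f g | Or f g => two_quantifier pi f /\ two_quantifier pi g
  | Imp f g => two_quantifier (~~ pi) f /\ two_quantifier pi g
  | Conj _ D f => forall i, D i ->
      if pi then two_quantifier pi (f i) else persistent pi (f i)
  | Disj _ D f => forall i, D i ->
      if pi then persistent pi (f i) else two_quantifier pi (f i)
  | All _ f => if pi then two_quantifier pi f else persistent pi f
  | Ex _ f => if pi then persistent pi f else two_quantifier pi f
  end.

Lemma sat_persistent (U : Type) (M N : structure tau U) f (v : nat -> U) :
  substructure M N -> (forall x, dom M (v x)) ->
  (persistent true f -> sat M v f -> sat N v f) /\
  (persistent false f -> sat N v f -> sat M v f).
Proof.
move=> MN; have [dMN _ _] := MN.
elim: f v => [s t|r ts|f IH|f IHf g IHg|f IHf g IHg|f IHf g IHg|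
              I D f IH|I D f IH|x f IH|x f IH] v Mv.
- by rewrite /= !(eval_substructure _ _ MN).
- by split=> _; rewrite (sat_rel_substructure _ MN Mv).
- have [u d] := IH v Mv.
  by split=> [/d k nf /k|/u k nf /k].
- have [u d] := IHf v Mv; have [u' d'] := IHg v Mv.
  by split=> /= -[k k'] [h h']; split; auto.
- have [u d] := IHf v Mv; have [u' d'] := IHg v Mv.
  by split=> /= -[k k'] [h|h]; [left|right|left|right]; auto.
- have [u d] := IHf v Mv; have [u' d'] := IHg v Mv.
  by split=> /= -[k k'] h h'; [apply: u' | apply: d'] => //; apply: h; auto.
- by split=> /= p k i Di; apply: (IH i v Mv).1 (p i Di) (k i Di) ||
                          apply: (IH i v Mv).2 (p i Di) (k i Di).
- split=> /= p [i [Di k]]; exists i; split=> //.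
    exact: (IH i v Mv).1 (p i Di) k.
  exact: (IH i v Mv).2 (p i Di) k.
- split=> [[]//|[_ p] k a Ma].
  by apply: (IH _ _).2 p (k a (dMN _ Ma)); apply: dom_update.
- split=> [[_ p] [a [Ma k]]|[]//]; exists a; split; first exact: dMN.
  by apply: (IH _ _).1 p k; apply: dom_update.
Qed.

Section DirectedUnion.
Context (U I : Type) (i0 : I) (M : I -> structure tau U).
Hypothesis directed : forall i j, exists k,
  substructure (M i) (M k) /\ substructure (M j) (M k).

Let N := union_structure i0 M.

Lemma substructure_union i : substructure (M i) N.
Proof.
split=> [a Ma|c|r a Ma]; first by exists i.
  have [k [[_ ck _] [_ c0 _]]] := directed i i0.
  by rewrite ck /= c0.
split=> [ra|[j ra]]; first by exists i.
have [k [[_ _ rik] [_ _ rjk]]] := directed i j.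
by apply/rik => //; apply/rjk => //; apply: rel_int_dom ra.
Qed.

(** A tuple has finitely many entries, so directedness puts it into one [M i]. *)
Lemma union_substructure (P : structure tau U) :
  (forall i, substructure (M i) P) -> substructure N P.
Proof.
move=> MP; split=> [a [i _ Ma]|c|r a Na].
- by have [le _ _] := MP i; apply: le.
- by have [_ e _] := MP i0; rewrite -e.
- split=> [[i ra]|ra].
    by have [_ _ h] := MP i; apply/h => //; apply: rel_int_dom ra.
  have [i ai] : exists i, forall l, dom (M i) (tnth a l).
    have : forall l, l \in enum 'I_(arity r) ->
        exists i, dom (M i) (tnth a l).
      by move=> l _; have [i _ h] := Na l; exists i.
    have: exists i, forall l, l \in enum 'I_(arity r) -> dom (M i) (tnth a l).
      elim: (enum _) => [|l s [i IH]]; first by exists i0.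
      have [j _ Mj] := Na l; have [k [[ik _ _] [jk _ _]]] := directed i j.
      exists k => l'; rewrite inE => /orP[/eqP ->|/IH]; first exact: jk.
      exact: ik.
    by move=> [i h] _; exists i => l; apply: h; rewrite mem_enum.
  by exists i; have [_ _ h] := MP i; apply/h.
Qed.

(** Stages are compared by [substructure] and not by an order on [I], so that
    directedness of the family is all that is used. *)
Definition eventually (i : I) (Q : structure tau U -> Prop) : Prop :=
  exists2 j, substructure (M i) (M j) &
    forall k, substructure (M j) (M k) -> Q (M k).

Lemma eventually_sub i (Q Q' : structure tau U -> Prop) :
  (forall k, substructure (M i) (M k) -> Q (M k) -> Q' (M k)) ->
  eventually i Q -> eventually i Q'.
Proof.
move=> QQ' [j ij Qj]; exists j => // k jk.
by apply: QQ'; [apply: substructure_trans jk|apply: Qj].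
Qed.

Lemma eventually_and i (Q Q' : structure tau U -> Prop) :
  eventually i Q -> eventually i Q' -> eventually i (fun P => Q P /\ Q' P).
Proof.
move=> [j ij Qj] [j' ij' Qj']; have [k [jk j'k]] := directed j j'.
exists k; first exact: substructure_trans jk.
by move=> l kl; split; [apply: Qj|apply: Qj']; apply: substructure_trans kl.
Qed.

Lemma eventually_all i (Q : structure tau U -> Prop) :
  (forall k, substructure (M i) (M k) -> Q (M k)) -> eventually i Q.
Proof. by exists i => //; apply: substructure_refl. Qed.

Lemma eventually_later i j (Q : structure tau U -> Prop) :
  substructure (M i) (M j) -> eventually j Q -> eventually i Q.
Proof. by move=> ij [k jk Qk]; exists k => //; apply: substructure_trans jk. Qed.

Lemma dom_later i j (v : nat -> U) :
  substructure (M i) (M j) -> (forall x, dom (M i) (v x)) ->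
  forall x, dom (M j) (v x).
Proof. by move=> [ij _ _] Mv x; apply: ij. Qed.

Lemma eventually_update i (v : nat -> U) x a (Q : structure tau U -> Prop) :
  (forall y, dom (M i) (v y)) -> dom N a ->
  (forall j, (forall y, dom (M j) (update v x a y)) -> eventually j Q) ->
  eventually i (fun P => dom P a /\ Q P).
Proof.
move=> Mv [j _ Ma] QM; have [k [ik jk]] := directed i j.
have Mka : dom (M k) a by have [le _ _] := jk; apply: le.
apply: (eventually_later ik); apply: eventually_and; last first.
  by apply: QM; apply: dom_update => //; apply: dom_later ik Mv.
by apply: eventually_all => l [kl _ _]; apply: kl.
Qed.

(** Both halves are proved together since negation and the premise of an
    implication exchange them. *)
Lemma eventually_sat f i (v : nat -> U) : (forall x, dom (M i) (v x)) ->
  (two_quantifier true f -> ~ sat N v f -> eventually i (fun P => ~ sat P v f))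
  /\ (two_quantifier false f -> sat N v f -> eventually i (fun P => sat P v f)).
Proof.
have up g w k l : persistent true g -> substructure (M k) (M l) ->
    (forall x, dom (M k) (w x)) -> sat (M l) w g -> sat N w g.
  move=> pg kl Mw; apply: (sat_persistent _ (substructure_union l) _).1 pg.
  exact: dom_later kl Mw.
have down g w k l : persistent false g -> substructure (M k) (M l) ->
    (forall x, dom (M k) (w x)) -> sat N w g -> sat (M l) w g.
  move=> pg kl Mw; apply: (sat_persistent _ (substructure_union l) _).2 pg.
  exact: dom_later kl Mw.
elim: f i v => [s t|r ts|f IH|f IHf g IHg|f IHf g IHg|f IHf g IHg|
                J D f IH|J D f IH|x f IH|x f IH] i v Mv.
- split=> _ h; apply: eventually_all => k ik.
    by move=> /up h'; apply: h; apply: h' ik Mv.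
  exact: down ik Mv h.
- split=> _ h; apply: eventually_all => k ik.
    by move=> /up h'; apply: h; apply: h' ik Mv.
  exact: down ik Mv h.
- have [n p] := IH i v Mv; split=> /= q.
    by move=> /contrapT/(p q); apply: eventually_sub => k _ h; apply.
  exact: n q.
- have [n p] := IHf i v Mv; have [n' p'] := IHg i v Mv; split=> /= -[q q'].
    move=> /not_andP[/(n q)|/(n' q')]; apply: eventually_sub => k _ h [];
    by [].
  by move=> [/(p q) ef /(p' q') eg]; apply: eventually_and.
- have [n p] := IHf i v Mv; have [n' p'] := IHg i v Mv; split=> /= -[q q'].
    move=> /not_orP[/(n q) ef /(n' q') eg].
    apply: eventually_sub (eventually_and ef eg) => k _ [nf ng] [].
      exact: nf.
    exact: ng.
  move=> [/(p q)|/(p' q')]; apply: eventually_sub => k _ h; [left|right].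
    exact: h.
  exact: h.
- have [n p] := IHf i v Mv; have [n' p'] := IHg i v Mv; split=> /= -[q q'].
    move=> /not_implyP[/(p q) ef /(n' q') eg].
    by apply: eventually_sub (eventually_and ef eg) => k _ [hf ng] /(_ hf)/ng.
  move=> h; have [/h/(p' q')|/(n q)] := pselect (sat N v f).
    by apply: eventually_sub => k _ hg _.
  by apply: eventually_sub => k _ nf /nf.
- split=> /= q.
    move=> /existsNP[j /not_implyP[Dj /((IH j i v Mv).1 (q j Dj))]].
    by apply: eventually_sub => k _ nf /(_ j Dj)/nf.
  move=> h; apply: eventually_all => k ik j Dj.
  exact: down (q j Dj) ik Mv (h j Dj).
- split=> /= q.
    move=> h; apply: eventually_all => k ik [j [Dj hj]]; apply: h.
    by exists j; split=> //; apply: up (q j Dj) ik Mv hj.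
  move=> [j [Dj /((IH j i v Mv).2 (q j Dj))]].
  by apply: eventually_sub => k _ h; exists j.
- split=> /= q.
    move=> /existsNP[a /not_implyP[Na h]].
    have := eventually_update Mv Na (fun j Mj => (IH j _ Mj).1 q h).
    by apply: eventually_sub => k _ [Ma nf] /(_ a Ma)/nf.
  move=> h; apply: eventually_all => k ik a Ma.
  have Mk y : dom (M k) (update v x a y).
    by apply: dom_update Ma y; apply: dom_later ik Mv.
  apply: down q (substructure_refl _) Mk _; apply: h.
  by exists k.
- split=> /= q.
    move=> h; apply: eventually_all => k ik [a [Ma ha]]; apply: h.
    exists a; split; first by exists k.
    have Mk y : dom (M k) (update v x a y).
    by apply: dom_update Ma y; apply: dom_later ik Mv.
    exact: up q (substructure_refl _) Mk ha.
  move=> [a [Na h]].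
  have := eventually_update Mv Na (fun j Mj => (IH j _ Mj).2 q h).
  by apply: eventually_sub => k _ [Ma hf]; exists a.
Qed.

(** If the sentence failed in the union, it would already fail at some stage. *)
Lemma models_union (s : sentence tau) :
  two_quantifier true s -> (forall i, models (M i) s) -> models N s.
Proof.
move=> q Ms v _; have [a0 Ma0] := dom_nonempty (M i0).
have closed w : sat N v s <-> sat N w s.
  by apply: eq_sat => x; rewrite sentence_closed.
(* The values of an assignment need not lie in a common stage; a sentence does
   not depend on them, so a constant assignment may be used instead. *)
apply/(closed (fun=> a0)); apply: contrapT.
have Mv (x : nat) : dom (M i0) a0 by [].
move=> /((eventually_sat s Mv).1 q)[j ij]/(_ j (substructure_refl _)).
by apply; apply: Ms; apply: dom_later ij Mv.
Qed.

End DirectedUnion.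

End Preservation.

(** * The downward Loewenheim-Skolem theorem *)

Lemma countable_setU (T : Type) (A B : set T) :
  countable A -> countable B -> countable (A `|` B).
Proof.
by move=> cA cB; rewrite -bigcup2E; apply: bigcup_countable => // -[|[|n]].
Qed.

Section Closure.
Context (U : Type).

(** Operations of any finite arity are represented by functions on finite
    sequences. *)
Definition closed_under (G : set (seq U -> U)) (A : set U) : Prop :=
  forall g s, G g -> List.Forall A s -> A (g s).

(** Let [kappa] be the disjoint sum of [X] and [nat].  The closure is exhausted
    by countably many stages, and stage [n.+1] is indexed by pairs of an
    operation and a finite sequence of indices for stage [n].  By [card_seq]
    and [card_square] these pairs are coded by [kappa], so that [kappa] indexes
    all stages. *)
Lemma small_closure (G : set (seq U -> U)) (X A : set U) (a0 : U) :
  countable G -> X `<=` A -> A a0 -> closed_under G A ->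
  exists D : set U, [/\ X `<=` D, D `<=` A, D a0, closed_under G D &
                     D #<= [set: X + nat]].
Proof.
move=> cG XA Aa0 GA; pose kappa : Type := (X + nat)%type.
have natk : [set: nat] #<= [set: kappa].
  by apply/card_leTP; exists inr => m n [].
have kinf : infinite_set [set: kappa] by apply/infiniteP.
have /card_leTP[i iI] : [set: nat * seq kappa] #<= [set: kappa].
  have /card_leTP[u uI] := natk.
  have /card_leTP[s sI] := card_seq kinf.
  have /card_leTP[j jI] := card_square kinf.
  apply/card_leTP; exists (fun p => j (u p.1, s p.2)) => -[n t] [n' t'] /=.
  by move=> /jI[/uI -> /sI ->].
have [q qK] := injective_cancel (0, [::]) iI.
(* Adjoining the projection [head a0] makes the stages increasing. *)
pose G' := G `|` [set head a0].
have GA' : closed_under G' A.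
  by move=> g s [Gg|->]; [apply: GA|case: s => [|a s As] //=; apply: List.Forall_inv As].
have [gam gamG] : exists gam : nat -> seq U -> U, range gam = G'.
  have : countable G' by apply: countable_setU => //; apply: countable1.
  have G'head : G' (head a0) by right.
  move=> /pfcard_geP[G0|[gam]]; first by rewrite G0 in G'head.
  by exists gam; apply/seteqP; split=> [_ [n _ <-]|]; [apply: funS|apply: surj].
pose h := fix h (n : nat) (k : kappa) : U :=
  if n is n.+1 then gam (q k).1 (map (h n) (q k).2)
  else match k with inl x => val x | inr _ => a0 end.
pose D := [set h n k | n in setT & k in setT].
have step n m s : exists k, h n.+1 k = gam m (map (h n) s).
  by exists (i (m, s)); rewrite /= qK.
have up n k : exists k', h n.+1 k' = h n k.
  have [m _ gm] : range gam (head a0) by rewrite gamG; right.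
  by have [k' e] := step n m [:: k]; exists k'; rewrite e gm.
have mono n m k : exists k', h (m + n) k' = h n k.
  elim: m => [|m [k' <-]]; first by exists k.
  exact: up.
exists D; split.
- by move=> x Xx; exists 0 => //; exists (inl (SigSub (mem_set Xx))).
- move=> _ [n _ [k _ <-]]; elim: n k => [|n IH] k /=.
    by case: k => // x; apply: XA; apply: set_valP.
  apply: GA'; first by rewrite -gamG; exists (q k).1.
  by elim: (q k).2 => //= k' s IHs; constructor.
- by exists 0 => //; exists (inr 0).
- move=> g s Gg Ds.
  have [m _ <-] : range gam g by rewrite gamG; left.
  have [n [t <-]] : exists n t, map (h n) t = s.
    elim: s Ds => [|a s IH] Ds; first by exists 0, [::].
    have [[n _ [k _ <-]] /IH[n' [t <-]]] := (List.Forall_cons_iff D a s).1 Ds.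
    have [k' e] := mono n n' k.
    have [t' et] : exists t', map (h (n' + n)) t' = map (h n') t.
      elim: t {Ds IH} => [|b t [t' et]]; first by exists [::].
      have [b' eb] := mono n' n b; exists (b' :: t') => /=.
      by rewrite et addnC eb.
    by exists (n' + n), (k' :: t'); rewrite /= e et.
  by have [k <-] := step n m t; exists n.+1 => //; exists k.
- apply: (@card_le_trans _ _ _ [set: nat * seq kappa]); last first.
    by apply/card_leTP; exists i.
  have -> : D = (fun p : nat * kappa => h p.1 p.2) @` setT.
    apply/seteqP; split=> [_ [n _ [k _ <-]]|_ [[n k] _ <-]].
      by exists (n, k).
    by exists n => //; exists k.
  apply: card_le_trans (card_image_le _ _) _.
  by apply/card_leTP; exists (fun p => (p.1, [:: p.2])) => -[n k] [n' k'] [-> ->].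
Qed.

End Closure.

Section LoewenheimSkolem.
Context (tau : vocabulary).

Section Skolem.
Context (U : Type) (N : structure tau U) (a0 : U).

(** Only finitely many variables matter, so an assignment is given by the finite
    sequence of the values of the first variables, padded with [a0].  A witness
    that does not exist is replaced by [a0]. *)
Definition witness (f : formula tau) (x : nat) (s : seq U) : U :=
  if pselect (exists a, dom N a /\ sat N (update (nth a0 s) x a) f)
    is left e then projT1 (cid e) else a0.

(** A universal quantifier contributes witnesses for the negation of its scope:
    a counterexample in the large structure must be reflected in the small one.
    The functions are collected directly, since a set of formulas would live in
    too large a universe for [set]. *)
Fixpoint skolem_functions (f : formula tau) : set (seq U -> U) :=
  match f with
  | Eq _ _ | Rel _ _ => set0
  | Neg f => skolem_functions f
  | And f g | Or f g | Imp f g => skolem_functions f `|` skolem_functions g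
  | Conj _ D f | Disj _ D f => \bigcup_(i in D) skolem_functions (f i)
  | All x f => witness (Neg f) x |` skolem_functions f
  | Ex x f => witness f x |` skolem_functions f
  end.

Lemma countable_skolem_functions f : countable (skolem_functions f).
Proof.
elim: f => [s t|r ts|f IH|f IHf g IHg|f IHf g IHg|f IHf g IHg|
            I D f IH|I D f IH|x f IH|x f IH] //=.
- exact: countable_setU.
- exact: countable_setU.
- exact: countable_setU.
- by apply: bigcup_countable.
- by apply: bigcup_countable.
- by apply: countable_setU => //; apply: countable1.
- by apply: countable_setU => //; apply: countable1.
Qed.

Lemma witness_dom f x s : dom N a0 -> dom N (witness f x s).
Proof. by rewrite /witness; case: pselect => // e _; case: cid => a []. Qed.

Lemma witnessP f x s a : dom N a -> sat N (update (nth a0 s) x a) f ->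
  sat N (update (nth a0 s) x (witness f x s)) f.
Proof.
move=> Na fa; rewrite /witness; case: pselect => [e|[]]; last by exists a.
by case: cid => b [].
Qed.

Lemma skolem_functions_closed f :
  dom N a0 -> closed_under (skolem_functions f) (dom N).
Proof.
move=> Na0 g s + _.
elim: f => //= [f IHf h IHh [/IHf|/IHh]|f IHf h IHh [/IHf|/IHh]|
                f IHf h IHh [/IHf|/IHh]|I D f IH [i Di /IH]|I D f IH [i Di /IH]|
                x f IH [->|/IH]|x f IH [->|/IH]] //; exact: witness_dom.
Qed.

Lemma closed_under_sub (G G' : set (seq U -> U)) A :
  G `<=` G' -> closed_under G' A -> closed_under G A.
Proof. by move=> GG' cl g s /GG'; apply: cl. Qed.

(** The Tarski-Vaught criterion.  The bound [n] on the free variables makes the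
    value of a Skolem function at an assignment depend on the first [n] values
    of the assignment only. *)
Lemma sat_skolem_closed (M : structure tau U) n f (v : nat -> U) :
  substructure M N ->
  closed_under (skolem_functions f) (dom M) ->
  (forall x, fv f x -> x < n) -> (forall x, dom M (v x)) ->
  sat M v f <-> sat N v f.
Proof.
move=> MN; have [dMN _ _] := MN.
have wit g x m (w : nat -> U) a : (forall y, fv g y -> y <> x -> y < m) ->
    (forall y, dom M (w y)) ->
    (forall s, List.Forall (dom M) s -> dom M (witness g x s)) ->
    dom N a -> sat N (update w x a) g ->
    exists2 b, dom M b & sat N (update w x b) g.
  move=> gm Mw cl Na ga; set s := mkseq w m.
  have e b : sat N (update w x b) g <-> sat N (update (nth a0 s) x b) g.
    apply: eq_sat => y gy; rewrite /update; case: eqP => // yx.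
    by rewrite nth_mkseq //; apply: gm.
  (* [s] agrees with [w] on all free variables of [g] other than [x]. *)
  exists (witness g x s); last by apply/e; apply: witnessP (Na) _; apply/e.
  apply: cl; rewrite /s /mkseq; elim: (iota _ _) => //= y r IHr.
  by constructor.
elim: f n v => [s t|r ts|f IH|f IHf g IHg|f IHf g IHg|f IHf g IHg|
                I D f IH|I D f IH|x f IH|x f IH] n v cl fn Mv.
- by rewrite /= !(eval_substructure _ _ MN).
- exact: sat_rel_substructure.
- by rewrite /= (IH n).
- rewrite /= (IHf n) ?(IHg n) //.
  + by apply: closed_under_sub cl; apply: subsetUr.
  + by move=> x gx; apply: fn; right.
  + by apply: closed_under_sub cl; apply: subsetUl.
  + by move=> x gx; apply: fn; left.
- rewrite /= (IHf n) ?(IHg n) //.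
  + by apply: closed_under_sub cl; apply: subsetUr.
  + by move=> x gx; apply: fn; right.
  + by apply: closed_under_sub cl; apply: subsetUl.
  + by move=> x gx; apply: fn; left.
- rewrite /= (IHf n) ?(IHg n) //.
  + by apply: closed_under_sub cl; apply: subsetUr.
  + by move=> x gx; apply: fn; right.
  + by apply: closed_under_sub cl; apply: subsetUl.
  + by move=> x gx; apply: fn; left.
- have e i : D i -> sat M v (f i) <-> sat N v (f i).
    move=> Di; apply: (IH i n) => // [|x fx].
      by apply: closed_under_sub cl => h fh; exists i.
    by apply: fn; exists i.
  by split=> h i Di; apply/(e i Di)/h.
- have e i : D i -> sat M v (f i) <-> sat N v (f i).
    move=> Di; apply: (IH i n) => // [|x fx].
      by apply: closed_under_sub cl => h fh; exists i.
    by apply: fn; exists i.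
  by split=> -[i [Di h]]; exists i; split=> //; apply/(e i Di).
- have e a : dom M a -> sat M (update v x a) f <-> sat N (update v x a) f.
    move=> Ma; apply: (IH (maxn n x.+1)); last exact: dom_update.
      by apply: closed_under_sub cl; apply: subsetUr.
    move=> y fy; rewrite leq_max; have [->|/eqP yx] := eqVneq y x.
      by rewrite ltnSn orbT.
    by rewrite fn //; split.
  split=> /= h; last by move=> a Ma; apply/(e a Ma)/h/dMN.
  move=> a Na; apply: contrapT => nf.
  have [||b Mb] := wit (Neg f) x n v a _ Mv _ Na nf.
  + by move=> y fy yx; apply: fn.
  + by move=> s Ms; apply: cl => //; left.
  + by apply; apply/(e b Mb)/h.
- have e a : dom M a -> sat M (update v x a) f <-> sat N (update v x a) f.
    move=> Ma; apply: (IH (maxn n x.+1)); last exact: dom_update.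
      by apply: closed_under_sub cl; apply: subsetUr.
    move=> y fy; rewrite leq_max; have [->|/eqP yx] := eqVneq y x.
      by rewrite ltnSn orbT.
    by rewrite fn //; split.
  split=> /= -[a [Ma h]]; first by exists a; split; [exact: dMN|apply/e].
  have [||b Mb fb] := wit f x n v a _ Mv _ Ma h.
  + by move=> y fy yx; apply: fn.
  + by move=> s Ms; apply: cl => //; left.
  + by exists b; split=> //; apply/e.
Qed.

End Skolem.

Lemma induced_substructure (U : Type) (N : structure tau U) (D : set U) :
  D !=set0 -> D `<=` dom N -> (forall c, D (const_int N c)) ->
  exists2 M, substructure M N & dom M = D.
Proof.
move=> D0 DN cD.
pose R r (a : (arity r).-tuple U) := rel_int N a /\ forall i, D (tnth a i).
have RD r (a : (arity r).-tuple U) : R r a -> forall i, D (tnth a i) by case.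
exists (Structure D0 RD cD) => //; split=> //= r a Da.
by split=> [[]|].
Qed.

(** The Skolem functions of the sentence and the constants generate the desired
    substructure. *)
Theorem downward_Loewenheim_Skolem (U : Type) (N : structure tau U) (X : set U)
    (s : sentence tau) :
  countable [set: const_sym tau] -> X `<=` dom N ->
  models N s ->
  exists M, [/\ substructure M N, models M s, X `<=` dom M &
             dom M #<= [set: X + nat]].
Proof.
move=> ctau XN Ns; have [a0 Na0] := dom_nonempty N.
pose G := skolem_functions N a0 s `|`
          range (fun c (_ : seq U) => const_int N c).
have cG : countable G.
  apply: countable_setU.
    exact: countable_skolem_functions.
  exact: sub_countable (card_image_le _ _) ctau.
have GN : closed_under G (dom N).
  move=> g t [sg|[c _ <-]]; first exact: skolem_functions_closed sg.
  by move=> _; apply: const_int_dom.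
have [D [XD DN Da0 GD cardD]] := small_closure cG XN Na0 GN.
have [|c|M MN dM] := @induced_substructure U N D _ DN _.
- by exists a0.
- by apply: (GD (fun=> const_int N c) [::]) => //; right; exists c.
exists M; split=> //; rewrite ?dM // => v Mv.
apply/(sat_skolem_closed (n := 0) (a0 := a0) MN) => //.
- by rewrite dM; apply: closed_under_sub GD; apply: subsetUl.
- by move=> x; rewrite sentence_closed.
- by apply: Ns => x; have [le _ _] := MN; apply: le.
Qed.

End LoewenheimSkolem.

(** * The abstract elementary class *)

(** The sentence, given as a concrete tree, is inspected node by node.  It passes
    because the premises of its implications contain no nested quantifiers, its
    positive existential quantifiers have quantifier-free scopes, and its
    infinite disjunctions are quantifier-free. *)
Lemma psi_two_quantifier (alpha : countable_ordinal) :
  two_quantifier true (Psi.psi alpha).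
Proof. by do ![split | move=> ? ? | move=> ?]. Qed.

Lemma countable_psi_voc (alpha : countable_ordinal) :
  countable [set: rel_sym (Psi.psi_voc alpha) + const_sym (Psi.psi_voc alpha)].
Proof.
pose code_rel (r : Psi.psi_rel alpha) : nat * Psi.index1 alpha :=
  match r with
  | Psi.RL d => (0, d)
  | Psi.Rlt d => (1, val d)
  | Psi.RF d => (2, Psi.incl d)
  | Psi.RS => (3, Psi.top alpha)
  | Psi.RV => (4, Psi.top alpha)
  | Psi.RT => (5, Psi.top alpha)
  | Psi.RG => (6, Psi.top alpha)
  end.
have code_relI : injective code_rel.
  by move=> [d| | | |d|d|] [d'| | | |d'|d'|] //= [] // => [->|/val_inj->|->].
pose code_const c := if c is Psi.C n then Some n else None.
have code_constI : injective code_const by move=> [|n] [|n'] //= [->].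
pose code t := match t with
  | inl r => inl (code_rel r) | inr c => inr (code_const c) end.
apply/countable_injP; exists (pickle \o code) => -[r|c] [r'|c'] _ _;
  move=> /(pcan_inj pickleK) //= [].
  by move=> /code_relI ->.
by move=> /code_constI ->.
Qed.

Lemma limit_order_total (I : Type) (R : rel I) i j :
  limit_order R -> R i j \/ R j i.
Proof.
move=> [wo _ _].
have [|k [[+ low] _]] := wo [pred k | `[< k = i \/ k = j >]].
  by exists i; apply/asboolP; left.
move=> /asboolP[ki|kj].
- by left; rewrite -ki; apply: low; apply/asboolP; right.
- by right; rewrite -kj; apply: low; apply/asboolP; left.
Qed.

Theorem theorem4p1 (alpha : countable_ordinal) :
  is_AEC (@K alpha) (@precK alpha) /\ LS_property (@K alpha) (@precK alpha) nat.
Proof.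
have cvoc := countable_psi_voc alpha.
have cconst : countable [set: const_sym (Psi.psi_voc alpha)].
  by apply: sub_countable cvoc; apply/card_leTP; exists inr => c c' [].
have LS : LS_property (@K alpha) (@precK alpha) nat.
  split=> // [|U N X KN XN]; first exact: infinite_nat.
  have [M [MN KM XM cM]] := downward_Loewenheim_Skolem cconst XN KN.
  by exists M.
split=> //; split.
- by move=> U M N [].
- by move=> U M KM; split=> //; apply: substructure_refl.
- by move=> U M N [_ _ MN] [_ _ NM]; apply: substructure_anti.
- by move=> U M N P [KM _ MN] [_ KP NP]; split=> //; apply: substructure_trans NP.
- by move=> U M N [].
- by move=> U U' M M' f; apply: isomorphism_models.
- move=> U U' M N M' N' f isoN isoM [KM KN MN]; split.
  + exact: isomorphism_models isoM KM.
  + exact: isomorphism_models isoN KN.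
  + exact: isomorphism_substructure isoN isoM MN.
- by move=> U M N P [KM _ _] [KN _ _] MN.
- move=> U I R i0 M [limR chainM].
  have tot i j : R i j \/ R j i := limit_order_total i j limR.
  have KM i : K (M i) by have [/chainM[]|/chainM[]] := tot i i.
  have directed i j : exists k,
      substructure (M i) (M k) /\ substructure (M j) (M k).
    have [/chainM[_ _ ij]|/chainM[_ _ ji]] := tot i j.
      by exists j; split=> //; apply: substructure_refl.
    by exists i; split=> //; apply: substructure_refl.
  have KU : K (union_structure i0 M).
    by apply: (models_union directed) KM; apply: psi_two_quantifier.
  split=> // [i|P MP]; first by split=> //; apply: substructure_union.
  split=> //; first by have [] := MP i0.
  by apply: (union_substructure i0 directed) => i; have [] := MP i.
- by exists nat.
Qed.
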